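(* Suppose that the fidelity function is strongly coercive: $\frac{C}{\lambda}\|v-f\|_{\mathcal Y}^\lambda\le\mathcal H(v\mid f)$ for all $v,f\in\mathcal Y$, where $\lambda\ge1$ and $C>0$ are constants. Assume that (i) $\mathcal J:\mathcal X\to[0,+\infty]$ is proper, convex, weakly-* lower semicontinuous with weakly-* sequentially compact non-empty sublevel sets; (ii) $\mathcal H:\mathcal Y\times\mathcal Y\to[0,+\infty]$ is proper, convex in its first argument, weakly-* lower semicontinuous jointly in both arguments, and $\mathcal H(v\mid f)=0$ iff $v=f$; (iii) $A,A^l_n,A^u_n:\mathcal X\to\mathcal Y$ are weak-* to weak-* continuous; (iv) there exists $\mu^\dagger\in\mathcal Y^*\times\mathcal Y^*$, $\mu^\dagger\ge0$, with $p^\dagger:=-B^*\mu^\dagger\in\partial\mathcal J(u^\dagger_{\mathcal J})$; (v) $A^l_n\le A\le A^u_n$ for all $n$, $\|A^u_n-A^l_n\|\le\eta_n\to0$, $\mathcal H(\bar f\mid f_n)\le\delta_n\to0$. For $\alpha>0$ let $(u^\alpha_n,v^\alpha_n)$ solve $$\min_{u\in\mathcal X,\ v\in\mathcal Y}\frac1\alpha\mathcal H(v\mid f_n)+\mathcal J(u)\quad\text{subject to}\quad A^l_nu\le v\le A^u_nu,$$ and let $\alpha_n>0$ be chosen according to the discrepancy principle $$\alpha_n=\sup\{\alpha>0:\mathcal H(v^\alpha_n\mid f_n)\le\tau\delta_n\},\qquad\tau>1,$$ with $v^{\alpha_n}_n$ such that $\mathcal H(v^{\alpha_n}_n\mid f_n)=\tau\delta_n$.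 Then $$D^{p^\dagger}_{\mathcal J}(u^{\alpha_n}_n,u^\dagger_{\mathcal J})=O\left(\delta_n^{\frac1\lambda}+\eta_n\right).$$
   Context: $\mathcal X=\mathcal U^*$ and $\mathcal Y=\mathcal V^*$ are duals of Banach lattices with the dual norm and dual partial order ($y\ge0$ iff $\langle y,v\rangle\ge0$ for all $v\in\mathcal V$, $v\ge0$); orders on products are componentwise. $A:\mathcal X\to\mathcal Y$ is bounded linear and regular (difference of two positive operators), $A^l_n,A^u_n$ bounded linear, $A^l_n\le A\le A^u_n$ means $A^l_nu\le Au\le A^u_nu$ for all $u\ge0$. $\bar f,f_n\in\mathcal Y$, $\delta_n>0$, and $\tau>1$ does not depend on $n$. $u^\dagger_{\mathcal J}\ge0$ satisfies $Au^\dagger_{\mathcal J}=\bar f$ and $\mathcal J(u^\dagger_{\mathcal J})\le\mathcal J(u)$ whenever $Au=\bar f$. $B:\mathcal X\to\mathcal Y\times\mathcal Y$, $Bu=(Au,-Au)$, with adjoint $B^*$. For $p\in\partial\mathcal J(w)$ the generalised Bregman distance is $D^p_{\mathcal J}(u,w)=\mathcal J(u)-\mathcal J(w)-\langle p,u-w\rangle$. *)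

(* Defs.v *)
From HB Require Import structures.
From mathcomp Require Import all_boot all_order all_algebra.
From mathcomp Require Import all_classical all_reals all_analysis.
Set Implicit Arguments.
Unset Strict Implicit.
Unset Printing Implicit Defensive.
Import Order.TTheory GRing.Theory Num.Theory numFieldNormedType.Exports.
Local Open Scope classical_set_scope.
Local Open Scope ring_scope.

Definition bounded_linear (R : realType) (V W : normedModType R)
    (f : V -> W) : Prop :=
  linear f /\ exists M : R, forall x, `|f x| <= M * `|x|.

Section BoundedOperators.
Context (R : realType) (V W : normedModType R).

Definition bounded_linearb : pred (V -> W) := fun f => `[< bounded_linear f >].

Lemma bounded_linear_submod : submod_closed bounded_linearb.
Proof.
split => [|a f g].
  apply/asboolP; split.
    by move=> a x y; rewrite -[RHS]/(a *: 0 + 0) scaler0 addr0.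
  by exists 0 => x; rewrite -[X in X <= _]/(`|0 : W|) normr0 mul0r.
move=> /asboolP[lf [M fM]] /asboolP[lg [N gN]].
apply/asboolP; split.
  move=> b x y; rewrite -[LHS]/(a *: f _ + g _) lf lg !scalerDr !scalerA.
  by rewrite (mulrC a b) addrACA.
exists (`|a| * M + N) => x; rewrite -[X in X <= _]/(`|a *: f x + g x|) mulrDl.
rewrite (le_trans (ler_normD _ _))// lerD// normrZ -mulrA.
by rewrite ler_wpM2l.
Qed.

HB.instance Definition _ := GRing.isSubmodClosed.Build R (V -> W)
  bounded_linearb bounded_linear_submod.

Record blin := Blin { blin_fun :> V -> W ; _ : bounded_linearb blin_fun }.

HB.instance Definition _ := [isSub for blin_fun].
HB.instance Definition _ := [Choice of blin by <:].
HB.instance Definition _ := [SubChoice_isSubLmodule of blin by <:].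

Lemma blinP (f : blin) : bounded_linear f.
Proof. exact/asboolP/(valP f). Qed.

HB.instance Definition _ (f : blin) :=
  GRing.isLinear.Build R V W *:%R (blin_fun f) (blinP f).1.

Lemma blin_ext (f g : blin) : f =1 g -> f = g.
Proof. by move=> fg; apply/val_inj/funext. Qed.

Lemma blinDE (f g : blin) x : (f + g) x = f x + g x. Proof. by []. Qed.
Lemma blinZE a (f : blin) x : (a *: f) x = a *: f x. Proof. by []. Qed.

Definition opnorm (f : blin) : R :=
  sup [set `|f x| | x in [set x | `|x| <= 1]].

Let opnorm_has_sup (f : blin) : has_sup [set `|f x| | x in [set x | `|x| <= 1]].
Proof.
split; first by exists `|f 0|, 0 => //=; rewrite normr0.
have [_ [M fM]] := blinP f; exists `|M| => _ [x /= x1 <-].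
rewrite (le_trans (fM x))// (le_trans (ler_norm _))// normrM normr_id.
by rewrite ler_piMr.
Qed.

Lemma le_opnorm (f : blin) x : `|f x| <= opnorm f * `|x|.
Proof.
have [->|x0] := eqVneq x 0; first by rewrite linear0 !normr0 mulr0.
rewrite -ler_pdivrMr ?normr_gt0// mulrC -[`|x|^-1]ger0_norm ?invr_ge0//.
rewrite -normrZ -linearZ/=; apply: ub_le_sup => /=.
  by have [] := opnorm_has_sup f.
exists (`|x|^-1 *: x) => //=.
by rewrite normrZ normfV normr_id mulVf// normr_eq0.
Qed.

Lemma opnorm_le (f : blin) M : 0 <= M -> (forall x, `|f x| <= M * `|x|) ->
  opnorm f <= M.
Proof.
move=> M0 fM; apply: ge_sup; first by have [] := opnorm_has_sup f.
by move=> _ [x /= x1 <-]; rewrite (le_trans (fM x))// ler_piMr.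
Qed.

Lemma opnorm_ge0 (f : blin) : 0 <= opnorm f.
Proof.
apply: (le_trans (normr_ge0 (f 0))); apply: ub_le_sup.
  by have [] := opnorm_has_sup f.
by exists 0 => //=; rewrite normr0.
Qed.

Let opnormD f g : opnorm (f + g) <= opnorm f + opnorm g.
Proof.
apply: opnorm_le => [|x]; first by rewrite addr_ge0 ?opnorm_ge0.
by rewrite mulrDl (le_trans (ler_normD _ _))// lerD ?le_opnorm.
Qed.

Let opnormZ_le a f : opnorm (a *: f) <= `|a| * opnorm f.
Proof.
apply: opnorm_le => [|x]; first by rewrite mulr_ge0 ?opnorm_ge0.
by rewrite blinZE normrZ -mulrA ler_wpM2l ?le_opnorm.
Qed.

Let opnormZ a f : opnorm (a *: f) = `|a| * opnorm f.
Proof.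
apply/eqP; rewrite eq_le opnormZ_le /=.
have [->|a0] := eqVneq a 0; first by rewrite normr0 mul0r opnorm_ge0.
rewrite -ler_pdivlMl ?normr_gt0// -normfV.
by rewrite (le_trans _ (opnormZ_le _ _))// scalerA mulVf// scale1r.
Qed.

Let opnorm0_eq0 f : opnorm f = 0 -> f = 0.
Proof.
move=> f0; apply: blin_ext => x; apply/eqP; rewrite -normr_eq0 eq_le normr_ge0.
by rewrite andbT (le_trans (le_opnorm f x))// f0 mul0r.
Qed.

HB.instance Definition _ :=
  Lmodule_isNormed.Build R blin opnormD opnormZ opnorm0_eq0.

Lemma blin_normE (f : blin) : `|f| = opnorm f. Proof. by []. Qed.

Lemma ler_blin_norm (f : blin) x : `|f x| <= `|f| * `|x|.
Proof. exact: le_opnorm. Qed.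

End BoundedOperators.

(* [Order.POrder] cannot be joined with [NormedModule] after the fact (the
   hierarchy already has [Num.NumDomain] as the join of an order and a norm), so
   the order of an ordered normed space is a relation of its own.
   Antisymmetry is not required here: it is part of [isBanachLattice], and for
   the dual of a Banach lattice it is the lemma [dual_vle_anti]. *)
HB.mixin Record hasVectorOrder (R : realType) V of NormedModule R V := {
  vle : V -> V -> Prop ;
  vle_refl : forall x, vle x x ;
  vle_trans : forall y x z, vle x y -> vle y z -> vle x z }.

#[short(type="orderedNormedModType")]
HB.structure Definition OrderedNormedModule (R : realType) :=
  {V of NormedModule R V & hasVectorOrder R V}.

Notation "x <=^v y" := (vle x y) (at level 70, no associativity) : ring_scope.

Section RealOrder.
Context (R : realType).

Definition regular_vle (x y : R^o) : Prop := ((x : R) <= y).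

Lemma regular_vle_refl x : regular_vle x x. Proof. exact: lexx. Qed.

Lemma regular_vle_trans y x z : regular_vle x y -> regular_vle y z ->
  regular_vle x z.
Proof. exact: le_trans. Qed.

HB.instance Definition _ := hasVectorOrder.Build R R^o
  regular_vle_refl regular_vle_trans.

Lemma vle_regularE (x y : R^o) : (x <=^v y) = is_true ((x : R) <= y).
Proof. by []. Qed.

End RealOrder.

Section ProductOrder.
Context (R : realType) (V W : orderedNormedModType R).

Definition prod_vle (x y : V * W) : Prop := (x.1 <=^v y.1) /\ (x.2 <=^v y.2).

Lemma prod_vle_refl x : prod_vle x x. Proof. by split; exact: vle_refl. Qed.

Lemma prod_vle_trans y x z : prod_vle x y -> prod_vle y z -> prod_vle x z.
Proof.
by move=> [xy1 xy2] [yz1 yz2]; split; [exact: vle_trans yz1|exact: vle_trans yz2].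
Qed.

HB.instance Definition _ := hasVectorOrder.Build R (V * W)%type
  prod_vle_refl prod_vle_trans.

Lemma vle_prodE (x y : V * W) :
  (x <=^v y) = ((x.1 <=^v y.1) /\ (x.2 <=^v y.2)).
Proof. by []. Qed.

End ProductOrder.

Section OperatorOrder.
Context (R : realType) (V W : orderedNormedModType R).

Definition blin_vle (f g : blin V W) : Prop :=
  forall u, 0 <=^v u -> f u <=^v g u.

Lemma blin_vle_refl f : blin_vle f f. Proof. by move=> u _; exact: vle_refl. Qed.

Lemma blin_vle_trans g f h : blin_vle f g -> blin_vle g h -> blin_vle f h.
Proof. by move=> fg gh u u0; exact: vle_trans (fg u u0) (gh u u0). Qed.

HB.instance Definition _ := hasVectorOrder.Build R (blin V W)
  blin_vle_refl blin_vle_trans.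

Lemma vle_blinE (f g : blin V W) :
  (f <=^v g) = (forall u, 0 <=^v u -> f u <=^v g u).
Proof. by []. Qed.

Definition regular_operator (A : blin V W) : Prop :=
  exists P Q : blin V W, [/\ 0 <=^v P, 0 <=^v Q & A = P - Q].

End OperatorOrder.

(* A real Banach lattice, given by its binary suprema: [vjoin x (- x)] is the
   absolute value of [x], and meets are [- vjoin (- x) (- y)]. *)
HB.mixin Record isBanachLattice (R : realType) U
    of CompleteNormedModule R U & OrderedNormedModule R U := {
  vle_anti : forall x y : U, x <=^v y -> y <=^v x -> x = y ;
  vleD2r : forall z x y : U, x <=^v y -> x + z <=^v y + z ;
  vscale_ge0 : forall (a : R) (x : U), 0 <= a -> 0 <=^v x -> 0 <=^v a *: x ;
  vjoin : U -> U -> U ;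
  vjoin_ubl : forall x y, x <=^v vjoin x y ;
  vjoin_ubr : forall x y, y <=^v vjoin x y ;
  vjoin_least : forall x y z, x <=^v z -> y <=^v z -> vjoin x y <=^v z ;
  lattice_norm : forall x y : U,
    vjoin x (- x) <=^v vjoin y (- y) -> `|x| <= `|y| }.

#[short(type="banachLatticeType")]
HB.structure Definition BanachLattice (R : realType) :=
  {U of CompleteNormedModule R U & OrderedNormedModule R U
   & isBanachLattice R U}.

Section Dual.
Context (R : realType).

Definition dual (V : normedModType R) := blin V R^o.

Lemma dual_vle_anti (U : banachLatticeType R) (f g : blin U R^o) :
  f <=^v g -> g <=^v f -> f = g.
Proof.
move=> fg gf; have pos (x : U) : 0 <=^v x -> f x = g x.
  by move=> x0; apply/eqP; rewrite eq_le; apply/andP; split;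
    [exact: fg|exact: gf].
apply: blin_ext => x; rewrite -[x](subKr (vjoin x 0)) [LHS]linearB [RHS]linearB.
congr (_ - _); apply: pos; first exact: vjoin_ubr.
by rewrite -[X in X <=^v _](subrr x); apply: vleD2r; exact: vjoin_ubl.
Qed.

Lemma adjoint_subproof (V W : normedModType R) (T : blin V W) (f : dual W) :
  bounded_linearb (fun x => f (T x)).
Proof.
apply/asboolP; split=> [a x y|]; first by rewrite !linearP.
exists (`|f| * `|T|) => x; rewrite (le_trans (ler_blin_norm f _))// -mulrA.
by rewrite ler_wpM2l// ler_blin_norm.
Qed.

Definition adjoint (V W : normedModType R) (T : blin V W) (f : dual W) :
  dual V := Blin (adjoint_subproof T f).

Lemma dual_pair_subproof (V W : normedModType R) (mu : dual V * dual W) :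
  bounded_linearb (fun x : V * W => (mu.1 x.1 + mu.2 x.2 : R^o)).
Proof.
apply/asboolP; split=> [a x y|].
  by rewrite /= !linearP scalerDr addrACA.
exists (`|mu.1| + `|mu.2|) => x; rewrite (le_trans (ler_normD _ _))// mulrDl.
by rewrite lerD// (le_trans (ler_blin_norm _ _))// ler_wpM2l// prod_normE
  le_max lexx ?orbT.
Qed.

(* The identification of [dual V * dual W] with the dual of [V * W]. *)
Definition dual_pair (V W : normedModType R) (mu : dual V * dual W) :
  dual (V * W)%type := Blin (dual_pair_subproof mu).

Lemma plus_minus_subproof (V W : normedModType R) (A : blin V W) :
  bounded_linearb (fun u => (A u, - A u)).
Proof.
apply/asboolP; split=> [a x y|].
  by apply/pair_equal_spec; rewrite /= linearP opprD scalerN.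
by exists `|A| => x; rewrite prod_normE /= normrN ge_max ler_blin_norm.
Qed.

Definition plus_minus (V W : normedModType R) (A : blin V W) :
  blin V (W * W)%type := Blin (plus_minus_subproof A).

(* The weak-* topology: the topology of pointwise convergence on [V]. *)
Definition weak_star (V : normedModType R) :=
  initial_topology (fun f : dual V => (f : {ptws V -> R^o})).

Lemma weak_star_cvgP (V : normedModType R) (x : nat -> weak_star V)
    (l : weak_star V) :
  x @ \oo --> l <->
  forall w, (fun n => (x n : dual V) w : R^o) @ \oo --> ((l : dual V) w : R^o).
Proof.
split => [xl w|xl].
  have inc : {for l, continuous
      ((fun f : dual V => (f : {ptws V -> R^o})) : weak_star V -> _)}.
    exact: initial_continuous.
  have /pointwise_cvgP/(_ w) := cvg_comp _ _ xl inc.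
  exact.
move=> A [B [[C Co <-] Cl CA]].
have : nbhs (l : {ptws V -> R^o}) C by exact: open_nbhs_nbhs.
have /pointwise_cvgP ptxl : forall t, (fun g => g t) @
    ((fun n => (x n : {ptws V -> R^o})) @ \oo) --> (l : {ptws V -> R^o}) t.
  exact: xl.
move=> /ptxl; apply: (@filterS _ \oo) => n Cn; exact: CA.
Qed.

End Dual.

Definition sequentially_compact (T : topologicalType) (K : set T) : Prop :=
  forall x : nat -> T, (forall n, K (x n)) ->
  exists phi : nat -> nat, {homo phi : m n / (m < n)%N} /\
    exists2 l, K l & (fun n => x (phi n)) @ \oo --> l.

Section ExtendedRealFunctionals.
Context (R : realType).
Local Open Scope ereal_scope.

Definition proper_functional (T : Type) (F : T -> \bar R) : Prop :=
  (forall x, F x != -oo) /\ exists x, F x != +oo.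

(* For functionals with values in [0, +oo], the convention [0 * +oo = 0] is
   harmless: at [t = 0] and [t = 1] the inequality is trivial. *)
Definition convex_functional (V : lmodType R) (F : V -> \bar R) : Prop :=
  forall (t : R) (x y : V), (0 <= t <= 1)%R ->
  F (t *: x + (1 - t) *: y)%R <= t%:E * F x + (1 - t)%:E * F y.

Definition subdifferential (V : normedModType R) (J : V -> \bar R) (w : V) :
    set (dual V) :=
  [set p | forall u, J w + (p (u - w)%R)%:E <= J u].

(* Used for [p] in [subdifferential J w], where [J] proper makes [J w] finite. *)
Definition bregman (V : normedModType R) (J : V -> \bar R) (p : dual V)
    (u w : V) : \bar R :=
  J u - J w - (p (u - w)%R)%:E.

Section ConstrainedProblem.
Context (X Y : orderedNormedModType R).
Context (J : X -> \bar R) (H : Y -> Y -> \bar R).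

Definition feasible (Al Au : blin X Y) (u : X) (v : Y) : Prop :=
  (Al u <=^v v)%R /\ (v <=^v Au u)%R.

Definition objective (alpha : R) (f : Y) (u : X) (v : Y) : \bar R :=
  alpha^-1%:E * H v f + J u.

Definition solves_problem (Al Au : blin X Y) (alpha : R) (f : Y)
    (u : X) (v : Y) : Prop :=
  feasible Al Au u v /\
  forall u' v', feasible Al Au u' v' ->
    objective alpha f u v <= objective alpha f u' v'.

End ConstrainedProblem.

End ExtendedRealFunctionals.

(* Main.v *)
Require Import Defs.
From mathcomp Require Import all_boot all_order all_algebra.
From mathcomp Require Import all_classical all_reals all_analysis.
From mathcomp Require Import lra.
Set Implicit Arguments.
Unset Strict Implicit.
Unset Printing Implicit Defensive.
Import Order.TTheory GRing.Theory Num.Theory numFieldNormedType.Exports.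
Local Open Scope classical_set_scope.
Local Open Scope ring_scope.

(** Write [x_n], [w_n] for the regularised solutions at [alpha n].

    The exact pair [(udag, fbar)] is feasible for every [n], because [udag] is
    positive, and by the discrepancy principle its fidelity is at most that of
    [w_n]. Minimality therefore gives [J x_n <= J udag]
    ([minimiser_penalty_le]). This is used twice. It keeps all [x_n] in one
    sublevel set of [J], which is norm bounded since it is weak-* sequentially
    compact ([weak_star_sequentially_compact_bounded]); and, as the source
    functional is [- B^* mu], it leaves
    [mu.1 (A x_n - fbar) - mu.2 (A x_n - fbar)] as an upper bound of the
    Bregman distance, which is nonnegative by the definition of a subgradient.

    That pairing splits at [w_n] ([source_pairing_le]). The distance from [w_n]
    to [fbar] is of order [delta n `^ lambda^-1], by coercivity and the
    triangle inequality through [f n]. The pairing with [A x_n - w_n] is at most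
    a constant times [eta n * `|x_n|], because the constraints put [A x_n - w_n]
    between [(A - Au n) x_n] and [(A - Al n) x_n]. The difficulty is that the
    minimisation does not force [x_n] to be positive, whereas the operator
    inequalities only speak of positive vectors. It is met by replacing [x_n]
    with a positive majorant of no larger norm, which exists in the dual of a
    Banach lattice by the Riesz-Kantorovich formula ([dual_pos_majorant]). *)

Arguments vle_trans {R s} [y x z] _ _.
Arguments vleD2r {R s} z [x y] _.
Arguments vscale_ge0 {R s} [a x] _ _.
Arguments vjoin_least {R s} [x y z] _ _.
Arguments lattice_norm {R s} [x y] _.

(** * Lattice arithmetic *)

Section BanachLatticeArithmetic.
Context (R : realType) (U : banachLatticeType R).
Implicit Types x y z a b : U.

Lemma vle_subr_ge0 x y : 0 <=^v y - x <-> x <=^v y.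
Proof.
split=> [/(vleD2r x)|/(vleD2r (- x))]; first by rewrite add0r subrK.
by rewrite subrr.
Qed.

Lemma vleD x y a b : x <=^v y -> a <=^v b -> x + a <=^v y + b.
Proof.
move=> xy ab; apply: vle_trans (vleD2r a xy) _.
by rewrite addrC [y + b]addrC; exact: vleD2r.
Qed.

Lemma vleN2 x y : x <=^v y -> - y <=^v - x.
Proof. by move=> /vle_subr_ge0 xy; apply/vle_subr_ge0; rewrite opprK addrC. Qed.

Lemma vle_addr_ge0 x y : 0 <=^v x -> 0 <=^v y -> 0 <=^v x + y.
Proof. by move=> x0 y0; rewrite -[X in X <=^v _]addr0; exact: vleD. Qed.

(** Add up [x <= |x|] and [- x <= |x|], then halve. *)
Lemma vabs_ge0 x : 0 <=^v vjoin x (- x).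
Proof.
have := vleD (vjoin_ubl x (- x)) (vjoin_ubr x (- x)).
rewrite subrr => /(vscale_ge0 (a := 2^-1)).
by rewrite scalerDr -scalerDl -div1r -splitr scale1r; apply; rewrite divr_ge0.
Qed.

Lemma norm_vle x y : 0 <=^v x -> x <=^v vjoin y (- y) -> `|x| <= `|y|.
Proof.
move=> x0 xy; apply: lattice_norm; apply: vjoin_least => //.
by apply: vle_trans (vleN2 x0) _; rewrite oppr0; exact: vabs_ge0.
Qed.

Lemma norm_vle_ge0 x y : 0 <=^v x -> x <=^v y -> `|x| <= `|y|.
Proof.
by move=> x0 xy; apply: norm_vle => //; exact: vle_trans (vjoin_ubl _ _).
Qed.

Definition pospart x : U := vjoin x 0.

Lemma pospart_ge0 x : 0 <=^v pospart x.
Proof. exact: vjoin_ubr. Qed.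

Lemma pospart_ge x : x <=^v pospart x.
Proof. exact: vjoin_ubl. Qed.

Lemma norm_pospart x : `|pospart x| <= `|x|.
Proof.
apply: norm_vle (pospart_ge0 x) _.
by apply: vjoin_least; [exact: vjoin_ubl|exact: vabs_ge0].
Qed.

(** [pospart x - x] is the negative part of [x]. *)
Lemma negpart_ge0 x : 0 <=^v pospart x - x.
Proof. exact/vle_subr_ge0/pospart_ge. Qed.

Lemma norm_negpart x : `|pospart x - x| <= `|x|.
Proof.
apply: norm_vle (negpart_ge0 x) _.
rewrite -[X in _ <=^v X](addrK x); apply: vleD2r; apply: vjoin_least.
  rewrite -[X in X <=^v _]add0r; apply: vleD (vabs_ge0 x) _.
  exact: vle_refl.
by rewrite -(addNr x); apply: vleD2r; exact: vjoin_ubr.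
Qed.

(** Riesz decomposition: the part of [z] in excess of [a], namely
    [pospart (z - a)], is below [b], and the rest is below [a]. *)
Lemma riesz_decomposition z a b : 0 <=^v a -> 0 <=^v b ->
    0 <=^v z -> z <=^v a + b ->
  exists z1 z2, [/\ z = z1 + z2, 0 <=^v z1, z1 <=^v a, 0 <=^v z2 & z2 <=^v b].
Proof.
move=> a0 b0 z0 zab; exists (z - pospart (z - a)), (pospart (z - a)).
split; [by rewrite subrK| | |exact: pospart_ge0|].
- apply/vle_subr_ge0/vjoin_least => //; apply/vle_subr_ge0.
  by rewrite opprB addrC subrK.
- apply/vle_subr_ge0; rewrite opprB addrCA -[a - z]opprB; exact: negpart_ge0.
- apply: vjoin_least => //; apply/vle_subr_ge0.
  by rewrite opprB addrA (addrC b); apply/vle_subr_ge0.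
Qed.

End BanachLatticeArithmetic.

(** * Positive majorants in the dual *)

Section PositiveMajorant.
Context (R : realType) (U : banachLatticeType R) (f : dual U).
Implicit Types w a b z : U.

(** The supremum of [f] over the order interval between [0] and [w]. It is
    additive and positively homogeneous on the positive cone, so its differences
    define a linear functional. *)
Definition order_sup w : R :=
  sup [set (f z : R) | z in [set z | 0 <=^v z /\ z <=^v w]].

Lemma order_sup_has_sup w : 0 <=^v w ->
  has_sup [set (f z : R) | z in [set z | 0 <=^v z /\ z <=^v w]].
Proof.
move=> w0; split.
  by exists (f 0), 0 => //; split => //; exact: vle_refl.
exists (`|f| * `|w|) => _ [z [z0 zw] <-].
rewrite (le_trans (ler_norm _))// (le_trans (ler_blin_norm f z))//.
by rewrite ler_wpM2l// norm_vle_ge0.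
Qed.

Lemma le_order_sup z w : 0 <=^v z -> z <=^v w -> (f z : R) <= order_sup w.
Proof.
move=> z0 zw; apply: ub_le_sup; last by exists z.
by have [] := order_sup_has_sup (vle_trans z0 zw).
Qed.

Lemma order_sup_le w M : 0 <=^v w ->
  (forall z, 0 <=^v z -> z <=^v w -> (f z : R) <= M) -> order_sup w <= M.
Proof.
move=> w0 fM; apply: ge_sup; first by have [] := order_sup_has_sup w0.
by move=> _ [z [z0 zw] <-]; exact: fM.
Qed.

Lemma order_sup_ge0 w : 0 <=^v w -> 0 <= order_sup w.
Proof.
move=> w0; rewrite -[X in X <= _](linear0 f).
by apply: le_order_sup => //; exact: vle_refl.
Qed.

Lemma order_sup_norm w : 0 <=^v w -> order_sup w <= `|f| * `|w|.
Proof.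
move=> w0; apply: order_sup_le => // z z0 zw.
rewrite (le_trans (ler_norm _))// (le_trans (ler_blin_norm f z))//.
by rewrite ler_wpM2l// norm_vle_ge0.
Qed.

(** By the Riesz decomposition, the sums of a point of the order interval of
    [a] and one of that of [b] exhaust the order interval of [a + b]. *)
Lemma order_supD a b : 0 <=^v a -> 0 <=^v b ->
  order_sup (a + b) = order_sup a + order_sup b.
Proof.
move=> a0 b0; apply/eqP; rewrite eq_le; apply/andP; split.
  apply: order_sup_le => [|z z0 zab]; first exact: vle_addr_ge0.
  have [z1 [z2 [-> z10 z1a z20 z2b]]] := riesz_decomposition a0 b0 z0 zab.
  by rewrite linearD; apply: lerD; exact: le_order_sup.
rewrite -lerBrDr; apply: order_sup_le => // z1 z10 z1a.
rewrite lerBrDl -lerBrDr; apply: order_sup_le => // z2 z20 z2b.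
rewrite lerBrDl -[_ + _]/(f z1 + f z2 : R) -linearD.
by apply: le_order_sup; [exact: vle_addr_ge0|exact: vleD].
Qed.

Lemma order_supZ_le t w : 0 < t -> 0 <=^v w ->
  order_sup (t *: w) <= t * order_sup w.
Proof.
move=> t0 w0; apply: order_sup_le => [|z z0 ztw].
  by apply: vscale_ge0 => //; exact: ltW.
have z_E : z = t *: (t^-1 *: z) by rewrite scalerA mulfV ?gt_eqF// scale1r.
rewrite z_E linearZ -[X in X <= _]/(t * f (t^-1 *: z)) ler_pM2l//.
have ti : 0 <= t^-1 by rewrite invr_ge0 ltW.
apply: le_order_sup; first exact: vscale_ge0.
apply/vle_subr_ge0.
have -> : w - t^-1 *: z = t^-1 *: (t *: w - z).
  by rewrite scalerBr scalerA mulVf ?gt_eqF// scale1r.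
by apply: vscale_ge0 => //; exact/vle_subr_ge0.
Qed.

Lemma order_sup0 : order_sup 0 = 0.
Proof.
have := order_supD (vle_refl 0) (vle_refl 0).
by rewrite addr0; lra.
Qed.

Lemma order_supZ t w : 0 <= t -> 0 <=^v w ->
  order_sup (t *: w) = t * order_sup w.
Proof.
rewrite le_eqVlt => /predU1P[<-|t0] w0.
  by rewrite scale0r mul0r order_sup0.
apply/eqP; rewrite eq_le order_supZ_le//=.
have ti : 0 < t^-1 by rewrite invr_gt0.
have := order_supZ_le ti (vscale_ge0 (ltW t0) w0).
by rewrite scalerA mulVf ?gt_eqF// scale1r ler_pdivlMl.
Qed.

Definition pos_majorant w : R :=
  order_sup (pospart w) - order_sup (pospart w - w).

(** [pos_majorant] does not depend on the decomposition of its argument as a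
    difference of positive vectors; its linearity rests on this. *)
Lemma pos_majorantE a b : 0 <=^v a -> 0 <=^v b ->
  pos_majorant (a - b) = order_sup a - order_sup b.
Proof.
move=> a0 b0; rewrite /pos_majorant; set w := a - b.
have := order_supD (pospart_ge0 w) b0.
have := order_supD (negpart_ge0 w) a0.
have -> : pospart w - w + a = pospart w + b.
  by rewrite [in LHS]/w opprB -addrA subrK.
lra.
Qed.

(** Both terms of [pos_majorant x] lie between [0] and the bound, so their
    difference does not cost a factor two. *)
Lemma norm_pos_majorant x : `|pos_majorant x| <= `|f| * `|x|.
Proof.
rewrite ler_norml /pos_majorant.
have p0 := pospart_ge0 x; have n0 := negpart_ge0 x.
have M0 := normr_ge0 f.
have := order_sup_ge0 p0; have := order_sup_ge0 n0.
have := ler_wpM2l M0 (norm_pospart x); have := ler_wpM2l M0 (norm_negpart x).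
have := order_sup_norm p0; have := order_sup_norm n0.
move=> *; apply/andP; split; lra.
Qed.

Lemma pos_majorant_bounded_linear : bounded_linearb (pos_majorant : U -> R^o).
Proof.
have dec w : exists w1 w2, [/\ 0 <=^v w1, 0 <=^v w2 & w = w1 - w2].
  exists (pospart w), (pospart w - w); split.
  - exact: pospart_ge0.
  - exact: negpart_ge0.
  - by rewrite opprB addrC subrK.
apply/asboolP; split=> [t x y|].
  have [x1 [x2 [x10 x20 ->]]] := dec x; have [y1 [y2 [y10 y20 ->]]] := dec y.
  rewrite -[RHS]/(t * pos_majorant (x1 - x2) + pos_majorant (y1 - y2)).
  rewrite [pos_majorant (x1 - x2)]pos_majorantE//.
  rewrite [pos_majorant (y1 - y2)]pos_majorantE//.
  have [t0|/ltW t0] := leP 0 t.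
    rewrite scalerBr addrACA -opprD.
    have tx1 := vscale_ge0 t0 x10; have tx2 := vscale_ge0 t0 x20.
    rewrite pos_majorantE; [|exact: vle_addr_ge0..].
    rewrite !order_supD// !order_supZ//; lra.
  (* a negative [t] exchanges the roles of the two parts of the vector *)
  have nt0 : 0 <= - t by rewrite oppr_ge0.
  have -> : t *: (x1 - x2) + (y1 - y2) = (- t *: x2 + y1) - (- t *: x1 + y2).
    by rewrite scalerBr opprD [RHS]addrACA !scaleNr opprK [- _ + _]addrC.
  have tx1 := vscale_ge0 nt0 x10; have tx2 := vscale_ge0 nt0 x20.
  rewrite pos_majorantE; [|exact: vle_addr_ge0..].
  rewrite !order_supD// !order_supZ//; lra.
by exists `|f| => x; exact: norm_pos_majorant.
Qed.

End PositiveMajorant.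

(** The Riesz-Kantorovich formula: the least positive majorant of [f] maps
    [w >= 0] to the supremum of [f] over the order interval between [0] and
    [w]. On that interval [f] is at most [`|f| * `|w|], hence the norm bound. *)
Lemma dual_pos_majorant (R : realType) (U : banachLatticeType R) (f : dual U) :
  exists p : dual U, [/\ 0 <=^v p, f <=^v p & `|p| <= `|f|].
Proof.
exists (Blin (pos_majorant_bounded_linear f)).
have pE w : 0 <=^v w -> pos_majorant f w = order_sup f w.
  move=> w0; rewrite -[w in LHS]subr0 pos_majorantE//; last exact: vle_refl.
  by rewrite order_sup0 subr0.
split=> [w w0|w w0|].
- by rewrite vle_regularE /= pE//; exact: order_sup_ge0.
- by rewrite vle_regularE /= pE//; apply: le_order_sup => //; exact: vle_refl.
- by apply: opnorm_le => // w; exact: norm_pos_majorant.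
Qed.

(** * Order and subtraction in a dual *)

Lemma blin_subE (R : realType) (V W : normedModType R) (f g : blin V W) x :
  (f - g) x = f x - g x.
Proof. by []. Qed.

Lemma dual_vle_subr_ge0 (R : realType) (V : orderedNormedModType R)
  (y z : blin V R^o) : 0 <=^v z - y <-> y <=^v z.
Proof.
by split=> yz w w0; have := yz w w0; rewrite !vle_regularE blin_subE subr_ge0.
Qed.

Lemma dual_vleB (R : realType) (V : orderedNormedModType R)
  (x y z t : blin V R^o) : x <=^v z -> t <=^v y -> x - y <=^v z - t.
Proof.
move=> xz ty w w0; rewrite vle_regularE !blin_subE.
exact: lerB (xz w w0) (ty w w0).
Qed.

Lemma pos_functional_mono (R : realType) (V : orderedNormedModType R)
    (mu : dual (blin V R^o)) y z : 0 <=^v mu -> y <=^v z -> (mu y : R) <= mu z.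
Proof.
move=> mu0 /dual_vle_subr_ge0 /mu0.
by rewrite vle_regularE [X in _ <= X]linearB subr_ge0.
Qed.

(** * Weak-* compactness and boundedness *)

(** A weak-* convergent sequence is pointwise bounded, hence norm bounded by the
    uniform boundedness principle. An unbounded set would contain a sequence
    [x] with [n < `|x n|], none of whose subsequences can therefore
    converge. *)
Lemma weak_star_sequentially_compact_bounded (R : realType)
    (U : completeNormedModType R) (K : set (dual U)) :
  sequentially_compact (K : set (weak_star U)) ->
  exists M : R, forall x, K x -> `|x| <= M.
Proof.
move=> Kcomp; apply: contrapT => /forallNP unb.
have /choice[x xP] (n : nat) : exists x : dual U, K x /\ n%:R < `|x|.
  have /existsNP[x /not_implyP[Kx /negP]] := unb n%:R.
  by rewrite -ltNge => nx; exists x.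
have [phi [phi_incr [l _ /weak_star_cvgP xl]]] := Kcomp x (fun n => (xP n).1).
pose F : set (U -> R^o) := [set g : U -> R^o | exists n, g = x (phi n)].
have [||M FM] := @Banach_Steinhauss R U R^o F _ _ 1.
- move=> _ [n ->]; split; last exact: (blinP (x (phi n))).1.
  move=> r; exists (`|x (phi n)| * r) => z zr.
  by rewrite (le_trans (ler_blin_norm _ _))// ler_wpM2l.
- move=> w; have /cvg_seq_bounded [M [_ Mx]] : cvgn (fun n => x (phi n) w : R^o).
    by apply/cvg_ex; exists (l w); exact: xl.
  by exists (M + 1) => _ [n ->]; apply: Mx => //; rewrite ltrDl.
have xM n : `|x (phi n)| <= M.
  apply: ge_sup; first by exists `|x (phi n) 0|, 0 => //=; rewrite normr0.
  by move=> _ [w /= w1 <-]; apply: FM => //; exists n.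
(* any index above [M] will do, as [n <= phi n < `|x (phi n)|] *)
pose n := (Num.truncn M).+1.
have phi_ge m : (m <= phi m)%N.
  by elim: m => // m IHm; exact: leq_ltn_trans IHm (phi_incr _ _ (ltnSn m)).
have := le_lt_trans (xM n) (truncnS_gt M).
by rewrite ltNge (le_trans _ (ltW (xP (phi n)).2))// ler_nat.
Qed.

(** * Positive functionals and operator gaps *)

(** The vector [x] need not be positive, so neither [T <= D] nor positivity of
    [mu] applies to it directly. A positive majorant [p] of [x] gives
    [mu (T x) <= mu (T p) <= mu (D p)]. *)
Lemma pos_functional_le_gap (R : realType) (U V : banachLatticeType R)
    (mu : dual (dual V)) (T D : blin (dual U) (dual V)) (x : dual U) :
    0 <=^v mu -> 0 <=^v T -> T <=^v D ->
  (mu (T x) : R) <= `|mu| * (`|D| * `|x|).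
Proof.
move=> mu0 T0 TD; have [p [p0 xp px]] := dual_pos_majorant x.
have Txp : T x <=^v T p.
  apply/dual_vle_subr_ge0; rewrite -linearB; apply: T0.
  exact/dual_vle_subr_ge0.
rewrite (le_trans (pos_functional_mono mu0 Txp))//.
rewrite (le_trans (pos_functional_mono mu0 (TD p p0)))//.
rewrite (le_trans (ler_norm _))// (le_trans (ler_blin_norm mu _))//.
rewrite ler_wpM2l// (le_trans (ler_blin_norm D _))//.
by rewrite ler_wpM2l.
Qed.

(** * Penalty, fidelity and source condition *)

(** At a point of finite penalty the subgradient inequality fails when
    [J w] is infinite. *)
Lemma subdifferential_fin_num (R : realType) (V : normedModType R)
    (J : V -> \bar R) (w : V) (p : dual V) :
  proper_functional J -> subdifferential J w p -> J w \is a fin_num.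
Proof.
move=> [Jninfty [u0 Ju0]] /(_ u0) sub; rewrite fin_numE Jninfty/=.
by apply/eqP => Jw; move: sub; rewrite Jw addye// leye_eq (negbTE Ju0).
Qed.

(** Where the fidelity of the minimiser is at least that of a competitor, the
    penalty of the minimiser is no larger. *)
Lemma minimiser_penalty_le (R : realType) (X Y : orderedNormedModType R)
    (J : X -> \bar R) (H : Y -> Y -> \bar R) (Al Au : blin X Y) (a : R)
    (g : Y) (u u' : X) (v v' : Y) :
    0 < a -> solves_problem J H Al Au a g u v -> feasible Al Au u' v' ->
    H v g \is a fin_num -> (H v' g <= H v g)%E ->
  (J u <= J u')%E.
Proof.
move=> a0 [_ umin] u'v' Hfin Hle; have := umin _ _ u'v'; rewrite /objective.
have aH : (a^-1%:E * H v' g <= a^-1%:E * H v g)%E.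
  by apply: lee_wpmul2l => //; rewrite lee_fin invr_ge0 ltW.
move=> /le_trans/(_ (leeD2r _ aH)); rewrite leeD2lE// fin_numM//.
Qed.

(** The constant and the power of [d] are kept apart: [t] will be [tau] or [1],
    and [d] the noise level. *)
Lemma powR_coercive_le (R : realType) (lambda C x t d : R) :
    1 <= lambda -> 0 < C -> 0 <= x -> 0 <= t -> 0 <= d ->
    C / lambda * x `^ lambda <= t * d ->
  x <= (lambda / C * t) `^ lambda^-1 * d `^ lambda^-1.
Proof.
move=> lambda1 C0 x0 t0 d0 xd; have l0 : 0 < lambda by exact: lt_le_trans lambda1.
rewrite -powRM//; last by rewrite !mulr_ge0// ?invr_ge0 ltW.
rewrite -[x in x <= _]powRr1// -(mulfV (lt0r_neq0 l0)) powRrM.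
apply: ge0_ler_powR; rewrite ?nnegrE ?invr_ge0 ?powR_ge0 ?(ltW l0)//.
  by rewrite !mulr_ge0// ?invr_ge0 ltW.
by rewrite -mulrA -ler_pdivrMl ?divr_gt0// invf_div.
Qed.

Lemma pairing_source_functional (R : realType) (V W : normedModType R)
    (A : blin V W) (mu : dual W * dual W) (x : V) :
  (- adjoint (plus_minus A) (dual_pair mu)) x = (mu.2 (A x) - mu.1 (A x) : R).
Proof.
rewrite -[LHS]/(- (mu.1 (A x) + mu.2 (- A x)) : R).
by rewrite linearN opprD opprK addrC.
Qed.

(** * The convergence rate *)

Lemma operator_vle_subr_ge0 (R : realType) (X V : orderedNormedModType R)
  (S T : blin X (blin V R^o)) : S <=^v T -> 0 <=^v T - S.
Proof. by move=> ST y y0; exact/dual_vle_subr_ge0/ST. Qed.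

Lemma operator_vleB (R : realType) (X V : orderedNormedModType R)
    (S1 S2 T1 T2 : blin X (blin V R^o)) :
  T1 <=^v T2 -> S2 <=^v S1 -> T1 - S1 <=^v T2 - S2.
Proof.
move=> T12 S21 y y0; rewrite !blin_subE.
by apply: dual_vleB; [exact: T12|exact: S21].
Qed.

(** Each half of [mu] is used with one side of the constraint: [mu.1] with
    [A x - w <= (A - Al) x] and [mu.2] with [w - A x <= (Au - A) x], where both
    gaps are positive operators below [Au - Al]. *)
Lemma source_pairing_le (R : realType) (U V : banachLatticeType R)
    (A Al Au : blin (dual U) (dual V)) (mu : dual (dual V) * dual (dual V))
    (x : dual U) (w g : dual V) :
    0 <=^v mu -> Al <=^v A -> A <=^v Au -> feasible Al Au x w ->
  (mu.1 (A x - g) - mu.2 (A x - g) : R) <=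
  (`|mu.1| + `|mu.2|) * (`|Au - Al| * `|x| + `|w - g|).
Proof.
move=> [mu1 mu2] AlA AAu [Alw wAu].
have gap1 : (mu.1 (A x - w) : R) <= `|mu.1| * (`|Au - Al| * `|x|).
  apply: le_trans (pos_functional_le_gap x mu1 (operator_vle_subr_ge0 AlA) _).
    apply: pos_functional_mono => //; apply: dual_vleB => //.
    exact: vle_refl.
  exact: operator_vleB (vle_refl _).
have gap2 : (mu.2 (w - A x) : R) <= `|mu.2| * (`|Au - Al| * `|x|).
  apply: le_trans (pos_functional_le_gap x mu2 (operator_vle_subr_ge0 AAu) _).
    apply: pos_functional_mono => //; apply: dual_vleB => //.
    exact: vle_refl.
  exact: operator_vleB (vle_refl _) _.
have := le_trans (ler_norm _) (ler_blin_norm mu.1 (w - g)).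
have := le_trans (ler_norm _) (ler_blin_norm mu.2 (g - w)).
rewrite [`|g - w|]distrC.
move: gap1 gap2; rewrite !linearB /= mulrDl !mulrDr.
set a1 := mu.1 (A x); set b1 := mu.1 w; set c1 := mu.1 g.
set a2 := mu.2 (A x); set b2 := mu.2 w; set c2 := mu.2 g.
(* the values of [mu] have type [R^o]; [lra] works with variables of type [R] *)
move: (a1 : R) (b1 : R) (c1 : R) (a2 : R) (b2 : R) (c2 : R).
move=> {a1 b1 c1 a2 b2 c2} a1 b1 c1 a2 b2 c2.
move=> g1 g2 h2 h1.
lra.
Qed.

Theorem mainTheorem17 (R : realType) (U V : banachLatticeType R)
  (J : dual U -> \bar R) (H : dual V -> dual V -> \bar R)
  (lambda C tau : R)
  (A : blin (dual U) (dual V)) (Al Au : nat -> blin (dual U) (dual V))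
  (fbar : dual V) (f : nat -> dual V) (delta eta : nat -> R)
  (udag : dual U) (mu : dual (dual V) * dual (dual V))
  (u : nat -> R -> dual U) (v : nat -> R -> dual V) (alpha : nat -> R)
  (* strong coercivity of the fidelity *)
  (lambda_ge1 : 1 <= lambda) (C_gt0 : 0 < C)
  (H_coercive : forall v f : dual V,
     ((C / lambda * (`|v - f| `^ lambda))%:E <= H v f)%E)
  (J_ge0 : forall u, (0 <= J u)%E)
  (J_proper : proper_functional J)
  (J_convex : convex_functional J)
  (J_lsc : lower_semicontinuous (J : weak_star U -> \bar R))
  (J_compact : forall c : R,
     sequentially_compact ([set u | (J u <= c%:E)%E] : set (weak_star U)))
  (H_ge0 : forall v f, (0 <= H v f)%E)
  (H_proper : proper_functional (fun z => H z.1 z.2))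
  (H_convex : forall f, convex_functional (fun v => H v f))
  (H_lsc : lower_semicontinuous
     (fun z : weak_star V * weak_star V => H z.1 z.2))
  (H_eq0 : forall v f, H v f = 0%E <-> v = f)
  (A_regular : regular_operator A)
  (A_cont : continuous (A : weak_star U -> weak_star V))
  (Al_cont : forall n, continuous (Al n : weak_star U -> weak_star V))
  (Au_cont : forall n, continuous (Au n : weak_star U -> weak_star V))
  (* the J-minimising solution *)
  (udag_ge0 : 0 <=^v udag)
  (udag_solution : A udag = fbar)
  (udag_min : forall u, A u = fbar -> (J udag <= J u)%E)
  (mu_ge0 : 0 <=^v mu)
  (source : subdifferential J udag (- adjoint (plus_minus A) (dual_pair mu)))
  (A_bounds : forall n, Al n <=^v A /\ A <=^v Au n)
  (eta_bound : forall n, `|Au n - Al n| <= eta n)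
  (eta_cvg0 : eta @ \oo --> (0 : R))
  (delta_gt0 : forall n, 0 < delta n)
  (delta_bound : forall n, (H fbar (f n) <= (delta n)%:E)%E)
  (delta_cvg0 : delta @ \oo --> (0 : R))
  (* regularised solutions and the discrepancy principle *)
  (uv_solution : forall n a, 0 < a ->
     solves_problem J H (Al n) (Au n) a (f n) (u n a) (v n a))
  (tau_gt1 : 1 < tau)
  (alpha_gt0 : forall n, 0 < alpha n)
  (alpha_sup : forall n, (alpha n)%:E =
     ereal_sup [set a%:E | a in
       [set a : R | 0 < a /\ (H (v n a) (f n) <= (tau * delta n)%:E)%E]])
  (discrepancy : forall n, H (v n (alpha n)) (f n) = (tau * delta n)%:E) :
  let D n := bregman J (- adjoint (plus_minus A) (dual_pair mu))
               (u n (alpha n)) udag in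
  (\forall n \near \oo, D n \is a fin_num) /\
  (fun n => fine (D n)) =O_\oo (fun n => delta n `^ lambda^-1 + eta n).
Proof.
have tau_gt0 : 0 < tau by exact: lt_trans tau_gt1.
have Jdag_fin := subdifferential_fin_num J_proper source.
have competitor n : feasible (Al n) (Au n) udag fbar.
  by rewrite -udag_solution;
    split; [exact: (A_bounds n).1|exact: (A_bounds n).2].
have delta_le n : delta n <= tau * delta n.
  by rewrite ler_peMl ?ltW.
have Ju_le n : (J (u n (alpha n)) <= J udag)%E.
  apply: minimiser_penalty_le (alpha_gt0 n) (uv_solution n _ (alpha_gt0 n))
    (competitor n) _ _.
    by rewrite discrepancy.
  by rewrite discrepancy (le_trans (delta_bound n))// lee_fin.
have Ju_fin n : J (u n (alpha n)) \is a fin_num.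
  by rewrite ge0_fin_numE// (le_lt_trans (Ju_le n))// -ge0_fin_numE.
have [M u_le] :=
  weak_star_sequentially_compact_bounded (J_compact (fine (J udag))).
have {}u_le n : `|u n (alpha n)| <= M.
  by apply: u_le; rewrite /= fineK.
have M_ge0 : 0 <= M by exact: le_trans (normr_ge0 _) (u_le 0%N).
move=> D.
have D_E n : D n = (fine (J (u n (alpha n))) - fine (J udag)
    + (mu.1 (A (u n (alpha n)) - fbar) - mu.2 (A (u n (alpha n)) - fbar) : R))%:E.
  rewrite /D /bregman pairing_source_functional.
  rewrite -[J (u n _)]fineK// -[J udag]fineK// [A (_ - udag)]linearB /= udag_solution.
  by rewrite opprB.
split; first by apply: nearW => n; rewrite D_E.
(* the constants of [powR_coercive_le]: [c tau] bounds the distance from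
   [v n (alpha n)] to [f n], and [c 1] that from [fbar] to [f n] *)
pose c t := (lambda / C * t) `^ lambda^-1.
pose K := (`|mu.1| + `|mu.2|) * (M + (c tau + c 1)).
have D_ge0 n : 0 <= fine (D n).
  rewrite fine_ge0// /D /bregman.
  rewrite leeBrDr// add0e leeBrDr// addeC; exact: source.
have w_le n : `|v n (alpha n) - fbar| <= (c tau + c 1) * delta n `^ lambda^-1.
  rewrite -(subrKA (f n)) (le_trans (ler_normD _ _))// mulrDl lerD//.
    apply: powR_coercive_le => //; [exact: ltW|exact: ltW|].
    by rewrite -lee_fin -discrepancy.
  rewrite distrC; apply: powR_coercive_le => //; first exact: ltW.
  by rewrite mul1r -lee_fin (le_trans (H_coercive _ _)).
have eta_ge0 n : 0 <= eta n by exact: le_trans (normr_ge0 _) (eta_bound n).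
have c_ge0 t : 0 <= c t by exact: powR_ge0.
have D_le n : fine (D n) <= K * (delta n `^ lambda^-1 + eta n).
  rewrite D_E /=; have JJ : fine (J (u n (alpha n))) <= fine (J udag).
    by rewrite fine_le.
  have := source_pairing_le fbar mu_ge0 (A_bounds n).1 (A_bounds n).2
    (uv_solution n _ (alpha_gt0 n)).1.
  set m := `|mu.1| + `|mu.2|; set d := delta n `^ lambda^-1.
  have m0 : 0 <= m by rewrite addr_ge0.
  have d0 : 0 <= d by exact: powR_ge0.
  have gap : `|Au n - Al n| * `|u n (alpha n)| + `|v n (alpha n) - fbar| <=
      (M + (c tau + c 1)) * (d + eta n).
    have := ler_pM (normr_ge0 _) (normr_ge0 _) (eta_bound n) (u_le n).
    have := w_le n; rewrite -/d.
    have := mulr_ge0 M_ge0 d0.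
    have := mulr_ge0 (addr_ge0 (c_ge0 tau) (c_ge0 1)) (eta_ge0 n).
    by move=> *; lra.
  have := ler_wpM2l m0 gap; rewrite mulrA -/K.
  by move=> *; lra.
(* [K] vanishes when [mu] does, but the constant has to be positive *)
apply/eqO_exP; exists (K + 1).
  by rewrite ltr_wpDl// mulr_ge0 ?addr_ge0.
apply: nearW => n; rewrite !ger0_norm//; last first.
  by rewrite addr_ge0// powR_ge0.
rewrite (le_trans (D_le n))// ler_wpM2r ?lerDl//.
by rewrite addr_ge0// powR_ge0.
Qed.
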